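(* Let $\alpha$ be an ordinal with $1\le\alpha\le\omega$. Each locally compact (Hausdorff) shift-continuous topology $\tau$ on the monoid $\mathcal{B}_{\alpha}$ coincides with the topology $\tau_{i,\alpha}$ for some non-zero ordinal $i\le\alpha$.
   Context: All topologies are assumed to be Hausdorff. A topology $\tau$ on a monoid $S$ is shift-continuous if for all $a,b\in S$ the map $S\to S$, $x\mapsto axb$, is continuous. Ordinals are von Neumann ordinals, $\omega^{\alpha}$ is ordinal exponentiation, and $+$ is ordinal addition. For ordinals $a\ge b$, $a-b$ denotes the unique ordinal $c$ with $a=b+c$. For $n\in\omega$ and an ordinal $t$, $n\omega^{t}$ denotes the sum of $n$ copies of $\omega^t$ (i.e. $\omega^t\cdot n$ in the standard notation for ordinal multiplication). $\mathbb{N}$ is the set of positive integers. For an ordinal $\alpha$, the $\alpha$-bicyclic monoid $\mathcal{B}_{\alpha}$ is the set $\omega^{\alpha}\times\omega^{\alpha}$ of pairs of ordinals less than $\omega^\alpha$, with the operation $(a,b)\cdot(c,d)=(a+(c-b),d)$ if $b\le c$, and $(a,b)\cdot(c,d)=(a,d+(b-c))$ if $b>c$. For ordinals $\alpha\le\omega$ and $0<i\le\alpha$, $\tau_{i,\alpha}$ denotes the locally compact Hausdorff shift-continuous topology on $\mathcal{B}_{\alpha}$ uniquely determined by the following two conditions: (i) for every integer $j$ with $i\le j<\alpha$ the point $(\omega^{j},\omega^{j})$ is isolated in $\tau_{i,\alpha}$; (ii) for every positive integer $j$ with $j<i$, a neighborhood base (of not necessarily open sets) of $\tau_{i,\alpha}$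 at $(\omega^{j},\omega^{j})$ consists of the sets $U_n=\{(a,b): a<\omega^j,\ b<\omega^j,\ \text{and } (n\omega^{j-1}<a \text{ or } n\omega^{j-1}<b)\}\cup\{(\omega^j,\omega^j)\}$, $n\in\mathbb{N}$. *)

(* Defs.v *)
From HB Require Import structures.
From mathcomp Require Import all_boot all_order all_algebra.
From mathcomp Require Import zify.
From mathcomp Require Import boolp classical_sets filter topology.

Set Implicit Arguments.
Unset Strict Implicit.
Unset Printing Implicit Defensive.

Import Order.TTheory GRing.Theory.

Local Open Scope nat_scope.

(* Ordinals below omega^omega in Cantor normal form: the polynomial with
   natural coefficients a_0, ..., a_n encodes
   omega^n * a_n + ... + omega^1 * a_1 + omega^0 * a_0.
   The semiring operations of {poly nat} are not the ordinal ones (the sum is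
   the Hessenberg sum); ordinal addition is [oadd].  The lemmas [ord_wf],
   [lt_oaddP], [lt_oexp0], [lt_oexpS] and [lt_omegaP] below determine the
   well-order and the operations intrinsically, hence up to the unique
   isomorphism with the von Neumann ordinals below omega^omega. *)
Definition ord : Type := {poly nat}.
HB.instance Definition _ := Choice.on ord.

Implicit Types a b c d : ord.

Definition ocoef (a : ord) (k : nat) : nat := nth 0 (polyseq a) k.
Definition osize (a : ord) : nat := size (polyseq a).

Lemma ocoefP a b : ocoef a =1 ocoef b -> a = b.
Proof. by move=> e; apply/polyP. Qed.

Lemma ocoef_ge a k : osize a <= k -> ocoef a k = 0.
Proof. exact: nth_default. Qed.

Lemma osize_gt a k : ocoef a k != 0 -> k < osize a.
Proof. by case: ltnP => // /ocoef_ge ->. Qed.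

Lemma osize_top a k : osize a = k.+1 -> ocoef a k != 0.
Proof.
move=> e; rewrite /ocoef; have := lead_coef_eq0 (a : {poly nat}).
rewrite lead_coefE -[size _]/(osize a) e /= => ->.
by rewrite -size_poly_eq0 -[size _]/(osize a) e.
Qed.

Definition olt a b : bool :=
  `[< exists k, ocoef a k < ocoef b k /\
                forall l, k < l -> ocoef a l = ocoef b l >].
Definition ole a b : bool := (a == b) || olt a b.

Lemma olt_irr : irreflexive olt.
Proof. by move=> a; apply/asboolP => -[k []]; rewrite ltnn. Qed.

Lemma olt_trans : transitive olt.
Proof.
move=> b a c /asboolP[k [hk ek]] /asboolP[l [hl el]]; apply/asboolP.
case: (ltngtP k l) => [kl|lk|kl].
- by exists l; split=> [|m lm]; [rewrite ek|rewrite ek ?el //; apply: ltn_trans lm].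
- by exists k; split=> [|m km]; [rewrite -el|rewrite ek // el //; apply: ltn_trans km].
- by subst l; exists k; split=> [|m km]; [lia|rewrite ek ?el].
Qed.

Lemma olt_total a b : a != b -> olt a b || olt b a.
Proof.
move=> ab.
have ex : exists k, ocoef a k != ocoef b k.
  apply: contrapT => h; case/eqP: ab; apply: ocoefP => k.
  by apply/eqP/negPn/negP => hk; apply: h; exists k.
have bd k : ocoef a k != ocoef b k -> k <= maxn (osize a) (osize b).
  by case: leqP => // h; rewrite !ocoef_ge //; lia.
case: (ex_maxnP ex bd) => k dk mk.
have e l : k < l -> ocoef a l = ocoef b l.
  by move=> kl; apply/eqP/negPn/negP => /mk; lia.
case: (ltngtP (ocoef a k) (ocoef b k)) dk => // h _; apply/orP; [left|right].
  by apply/asboolP; exists k.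
by apply/asboolP; exists k; split=> // l /e.
Qed.

Fact ord_display : Order.disp_t. Proof. exact: Order.Disp tt tt. Qed.

HB.instance Definition _ := Order.LtOrder.Build ord_display ord
  (fun _ _ => erefl) (fun _ _ => erefl) (fun _ _ => erefl)
  olt_irr olt_trans olt_total.

Local Open Scope order_scope.

Lemma ltoP a b : reflect (exists k, (ocoef a k < ocoef b k)%N /\
   forall l, (k < l)%N -> ocoef a l = ocoef b l) (a < b).
Proof. exact: asboolP. Qed.

(* [oexp k] is omega^k, [onat n] the finite ordinal n. *)
Definition oexp (k : nat) : ord := 'X^k%R.
Definition onat (n : nat) : ord := n%:P%R.
Definition omega : ord := oexp 1.

Definition mkord (n : nat) (f : nat -> nat) : ord := (\poly_(k < n) f k)%R.
Lemma ocoef_mk n f k : ocoef (mkord n f) k = if (k < n)%N then f k else 0.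
Proof. exact: coef_poly. Qed.
Lemma osize_mk n f : (osize (mkord n f) <= n)%N.
Proof. exact: size_poly. Qed.

(* If n is the leading exponent of b, the terms of a of exponent < n are
   absorbed and the coefficients at exponent n are added. *)
Definition oadd a b : ord :=
  mkord (maxn (osize a) (osize b)) (fun k =>
   if (k.+1 < osize b)%N then ocoef b k else (ocoef a k + ocoef b k)%N).

Lemma ocoef_add a b k : ocoef (oadd a b) k =
  if (k.+1 < osize b)%N then ocoef b k else (ocoef a k + ocoef b k)%N.
Proof.
rewrite ocoef_mk; case: ltnP => // h.
by case: ifP => h'; rewrite !ocoef_ge //; lia.
Qed.

Lemma osize_leP a n : reflect (forall k, (n <= k)%N -> ocoef a k = 0) (osize a <= n)%N.
Proof.
apply: (iffP idP) => [h k nk|h]; first by apply: ocoef_ge; lia.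
case e : (osize a) => [|m] //; have := osize_top e.
by case: (ltnP m n) => // /h ->.
Qed.

Lemma osize_add a b : osize (oadd a b) = maxn (osize a) (osize b).
Proof.
apply/eqP; rewrite eqn_leq osize_mk /=.
case e : (maxn _ _) => [|m] //; apply: osize_gt; rewrite ocoef_add.
have [ea|eb] : osize a = m.+1 \/ osize b = m.+1 by lia.
  by have := osize_top ea; case: ifP; lia.
by have := osize_top eb; case: ifP; lia.
Qed.

Definition ozero : ord := 0%R.
Lemma ocoef0 k : ocoef ozero k = 0.
Proof. exact: coef0. Qed.
Lemma osize0 : osize ozero = 0.
Proof. exact: size_poly0. Qed.

Lemma oaddA : associative oadd.
Proof.
move=> a b c; apply: ocoefP => k; rewrite !ocoef_add osize_add.
by have := @ocoef_ge b k; have := @ocoef_ge c k; do ?case: ifP; lia.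
Qed.

Lemma oadd0 a : oadd a ozero = a.
Proof. by apply: ocoefP => k; rewrite ocoef_add osize0 ocoef0 addn0. Qed.
Lemma o0add a : oadd ozero a = a.
Proof. by apply: ocoefP => k; rewrite ocoef_add ocoef0; case: ifP. Qed.

Lemma ltoadd2l a : {mono oadd a : b c / b < c}.
Proof.
have mono b c : b < c -> oadd a b < oadd a c.
  case/ltoP => k [hk ek]; apply/ltoP.
  have sb l : (k < l)%N -> (l < osize b)%N = (l < osize c)%N.
    move=> kl; rewrite !ltnNge; congr (~~ _).
    by apply/osize_leP/osize_leP => h m lm; have := ek m (leq_trans kl lm); have := h m lm; lia.
  have kc : (k < osize c)%N by apply: osize_gt; lia.
  exists k; split=> [|l kl]; rewrite !ocoef_add; last by rewrite sb ?ek //; lia.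
  by rewrite (sb k.+1) //; case: ifP; lia.
move=> b c; apply/idP/idP; last exact: mono.
by case: (ltgtP b c) => // [/mono|-> //]; rewrite ?ltxx // => /lt_trans h /h; rewrite ltxx.
Qed.
Lemma leo0 a : ozero <= a.
Proof.
rewrite leNgt; apply/negP => /ltoP[k []]; by rewrite ocoef0.
Qed.
Lemma leoadd2l a : {mono oadd a : b c / b <= c}.
Proof. by move=> b c; rewrite !leNgt ltoadd2l. Qed.
Lemma leo_addr a b : a <= oadd a b.
Proof. by rewrite -{1}(oadd0 a) leoadd2l leo0. Qed.
Lemma oaddI a : injective (oadd a).
Proof. by move=> b c e; apply/eqP; rewrite eq_le -(leoadd2l a b) -(leoadd2l a c) e lexx. Qed.

Lemma leo_exists a b : b <= a -> exists c, a = oadd b c.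
Proof.
rewrite le_eqVlt => /orP[/eqP ->|]; first by exists ozero; rewrite oadd0.
case/ltoP=> k [hk ek].
pose c := mkord k.+1 (fun l => if (l < k)%N then ocoef a l else ocoef a l - ocoef b l)%N.
have cl l : ocoef c l = if (l < k)%N then ocoef a l else if l == k then (ocoef a l - ocoef b l)%N else 0.
  by rewrite ocoef_mk; case: (ltngtP l k) => h; case: ifP; lia.
have sc : osize c = k.+1.
  apply/eqP; rewrite eqn_leq osize_mk; apply: osize_gt; rewrite cl ltnn eqxx; lia.
exists c; apply: ocoefP => l; rewrite ocoef_add sc cl.
have := ek l; case: (ltngtP l k) => h e; case: ifP => h'; subst => //; try lia.
Qed.

Definition osub a b : ord := xget ozero [set c | a = oadd b c].

Lemma osubK a b : b <= a -> oadd b (osub a b) = a.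
Proof. by move=> /leo_exists[c e]; rewrite /osub; case: xgetP => [d _ <-//|/(_ c)]. Qed.

Lemma oaddKl a b : osub (oadd a b) a = b.
Proof. by apply: (@oaddI a); rewrite osubK // leo_addr. Qed.

(* The sum of n copies of omega^k. *)
Definition omuln (n k : nat) : ord := iter n (fun a => oadd a (oexp k)) ozero.

Lemma lt_oaddP a b x :
  x < oadd a b <-> x < a \/ exists2 c, c < b & x = oadd a c.
Proof.
split=> [h|[h|[c cb ->]]]; last by rewrite ltoadd2l.
  case: (ltP x a) => [|/leo_exists[c e]]; first by left.
  by right; exists c; rewrite // -(ltoadd2l a) -e.
exact: lt_le_trans h (leo_addr _ _).
Qed.

Lemma ocoef_exp k l : ocoef (oexp k) l = (l == k).
Proof. by rewrite /ocoef /oexp coefXn; case: eqP. Qed.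
Lemma osize_exp k : osize (oexp k) = k.+1.
Proof. exact: size_polyXn. Qed.

Lemma lt_oexpE a k : (a < oexp k) = (osize a <= k)%N.
Proof.
apply/ltoP/osize_leP => [[l [hl el]] m km|h].
  move: hl; rewrite ocoef_exp; case: eqVneq => // e h; subst l.
  case: (eqVneq m k) => [->|mk]; first lia.
  by rewrite el ?ocoef_exp ?(negPf mk) //; lia.
exists k; split=> [|l kl]; first by rewrite ocoef_exp eqxx h.
by rewrite ocoef_exp h ?(ltnW kl) //; case: eqVneq => //; lia.
Qed.

Lemma ocoef_muln n k l : ocoef (omuln n k) l = if l == k then n else 0.
Proof.
elim: n => [|n IH]; first by rewrite ocoef0 if_same.
rewrite /omuln iterS -/(omuln n k) ocoef_add IH osize_exp ocoef_exp.
by case: eqVneq => h; case: ifP; lia.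
Qed.

Lemma lt_oexp0 x : x < oexp 0 <-> x = ozero.
Proof.
rewrite lt_oexpE; split=> [|->]; last by rewrite osize0.
move=> /osize_leP h; apply: ocoefP => k; by rewrite h // ocoef0.
Qed.

Lemma lt_oexpS k x : x < oexp k.+1 <-> exists n, x < omuln n k.
Proof.
rewrite lt_oexpE; split=> [/osize_leP h|[n]].
  exists (ocoef x k).+1; apply/ltoP; exists k.
  split=> [|l kl]; rewrite ocoef_muln ?eqxx // h //.
  by case: eqVneq kl => // ->; rewrite ltnn.
move=> /ltoP[l [hl el]]; apply/osize_leP => m km.
move: hl; rewrite ocoef_muln; case: eqVneq => // e _; subst l.
by rewrite el // ocoef_muln; case: eqVneq km => // ->; rewrite ltnn.
Qed.

Lemma ord_wf : well_founded (fun a b : ord => a < b).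
Proof.
have H n : forall a, a < oexp n -> Acc (fun a b : ord => a < b) a.
  elim: n => [|n IH].
    by move=> a /lt_oexp0 ->; constructor => b; rewrite ltNge leo0.
  have Hm m : forall a, a < omuln m n -> Acc (fun a b : ord => a < b) a.
    elim: m => [|m IHm] a; first by rewrite ltNge leo0.
    case/lt_oaddP => [/IHm //|[c hc ->]].
    have ac := IH c hc; elim: ac hc => {}c _ IHc hc; constructor => b.
    by case/lt_oaddP => [/IHm //|[d hd ->]]; apply: IHc => //; apply: lt_trans hd hc.
  by move=> a /lt_oexpS[m]; apply: Hm.
by move=> a; apply: (H (osize a)); rewrite lt_oexpE.
Qed.

Lemma ocoef_nat n k : ocoef (onat n) k = if k == 0 then n else 0.
Proof. by rewrite /ocoef /onat coefC. Qed.

Lemma onatE n : onat n = omuln n 0.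
Proof. by apply: ocoefP => k; rewrite ocoef_nat ocoef_muln. Qed.

Lemma lt_onat m n : (onat m < onat n) = (m < n)%N.
Proof.
apply/ltoP/idP => [[k []]|h].
  by rewrite !ocoef_nat; case: ifP.
by exists 0; split=> [|l]; rewrite !ocoef_nat //; case: eqVneq => // ->.
Qed.

Lemma lt_omegaP x : x < omega <-> exists n, x = onat n.
Proof.
rewrite lt_oexpE; split=> [/osize_leP h|[n ->]].
  by exists (ocoef x 0); apply: ocoefP => k; rewrite ocoef_nat; case: eqVneq => [->//|k0]; rewrite h //; lia.
by apply/osize_leP => k k1; rewrite ocoef_nat; case: eqVneq => //; lia.
Qed.

(* a < omega^alpha, for an ordinal alpha <= omega: all the exponents of the
   Cantor normal form of a are < alpha.  A formula is needed because
   omega^omega itself is not in [ord]; see [in_wexp_onat], [in_wexp_omega]. *)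
Definition in_wexp (alpha a : ord) : bool :=
  [forall k : 'I_(osize a), (ocoef a k != 0) ==> (onat k < alpha)].

Lemma in_wexpP alpha a :
  reflect (forall k, ocoef a k != 0 -> onat k < alpha) (in_wexp alpha a).
Proof.
apply: (iffP forallP) => [h k k0|h k]; last by apply/implyP/h.
by have /implyP := h (Ordinal (osize_gt k0)); apply.
Qed.

Lemma in_wexp_onat n a : in_wexp (onat n) a = (a < oexp n).
Proof.
rewrite lt_oexpE; apply/in_wexpP/osize_leP => h k.
  by case: (eqVneq (ocoef a k) 0) => // /h; rewrite lt_onat; lia.
by rewrite lt_onat ltnNge => k0; apply: contra k0 => /h ->.
Qed.

Lemma in_wexp_omega a : in_wexp omega a.
Proof. by apply/in_wexpP => k _; apply/lt_omegaP; exists k. Qed.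

Lemma in_wexp_add alpha a b :
  in_wexp alpha a -> in_wexp alpha b -> in_wexp alpha (oadd a b).
Proof.
move=> /in_wexpP ha /in_wexpP hb; apply/in_wexpP => k; rewrite ocoef_add.
case: ifP => _; first exact: hb.
by rewrite addn_eq0 negb_and => /orP[/ha|/hb].
Qed.

Lemma in_wexp_sub alpha a b : b <= a -> in_wexp alpha a -> in_wexp alpha (osub a b).
Proof.
move=> /osubK {1}<- /in_wexpP h; apply/in_wexpP => k k0; apply: h.
by rewrite ocoef_add; case: ifP => // _; lia.
Qed.

Lemma in_wexp_exp alpha k : onat k < alpha -> in_wexp alpha (oexp k).
Proof. by move=> h; apply/in_wexpP => l; rewrite ocoef_exp; case: (eqVneq l k) => // ->. Qed.

Record bicyclic (alpha : ord) := Bicyclic {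
  bpair :> ord * ord;
  _ : in_wexp alpha bpair.1 && in_wexp alpha bpair.2 }.
HB.instance Definition _ alpha := [isSub for @bpair alpha].
HB.instance Definition _ alpha := [Choice of bicyclic alpha by <:].

Definition pmul (x y : ord * ord) : ord * ord :=
  if x.2 <= y.1 then (oadd x.1 (osub y.1 x.2), y.2)
  else (x.1, oadd y.2 (osub x.2 y.1)).

(* A pair (a, b) is represented by the partial map b + t |-> a + t. *)
Definition pact (x : ord * ord) (t : ord) : option ord :=
  if x.2 <= t then Some (oadd x.1 (osub t x.2)) else None.

Lemma pact_mul x y t : pact (pmul x y) t = obind (pact x) (pact y t).
Proof.
case: x y => [a b] [c d]; rewrite /pmul /pact /=.
case: (leP b c) => /= [/leo_exists[e ->]|/ltW/leo_exists[e ->]]; rewrite oaddKl.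
  case: (leP d t) => //= /leo_exists[f ->].
  by rewrite oaddKl -!oaddA leo_addr oaddKl.
case: (leP d t) => /= [/leo_exists[f ->]|td]; last first.
  by case: leP => // h; have := lt_le_trans td (le_trans (leo_addr d e) h); rewrite ltxx.
rewrite oaddKl !leoadd2l; case: leP => // /leo_exists[g ->].
by rewrite !oaddA !oaddKl.
Qed.

Lemma pact_inj x y : pact x =1 pact y -> x = y.
Proof.
case: x y => [a b] [c d] h.
have e : b = d.
  apply: le_anti; have := h b; have := h d; rewrite /pact /= !lexx.
  by case: (b <= d); case: (d <= b).
subst d; move: (h b); rewrite /pact /= lexx.
have -> : osub b b = ozero by rewrite -{1}(oadd0 b) oaddKl.
by rewrite !oadd0 => -[->].
Qed.

Lemma pmulA : associative pmul.
Proof.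
move=> x y z; apply: pact_inj => t; rewrite !pact_mul.
by case: (pact z t) => //= u; rewrite pact_mul.
Qed.

Section Bicyclic.
Variable alpha : ord.

Lemma bmul_subproof (x y : bicyclic alpha) :
  in_wexp alpha (pmul x y).1 && in_wexp alpha (pmul x y).2.
Proof.
case: x y => [[a b] /= /andP[ha hb]] [[c d] /= /andP[hc hd]].
rewrite /pmul /=; case: leP => /= [h|/ltW h]; rewrite ?ha ?hd ?andbT.
  by apply: in_wexp_add => //; apply: in_wexp_sub.
by apply: in_wexp_add => //; apply: in_wexp_sub.
Qed.

Definition bmul (x y : bicyclic alpha) : bicyclic alpha :=
  Bicyclic (bmul_subproof x y).

Lemma bone_subproof : in_wexp alpha ozero && in_wexp alpha ozero.
Proof. by rewrite andbb; apply/in_wexpP => k; rewrite ocoef0. Qed.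

Definition bone : bicyclic alpha := @Bicyclic alpha (ozero, ozero) bone_subproof.

Lemma bmulA : associative bmul.
Proof. by move=> x y z; apply/val_inj/pmulA. Qed.
Lemma osub0 a : osub a ozero = a.
Proof. by rewrite -{1}(o0add a) oaddKl. Qed.
Lemma bmul1x : left_id bone bmul.
Proof.
by case=> -[a b] h; apply: val_inj; rewrite /= /pmul /= leo0 o0add osub0.
Qed.
Lemma bmulx1 : right_id bone bmul.
Proof.
case=> -[a b] h; apply: val_inj; rewrite /= /pmul /=.
case: leP => [b0|_]; last by rewrite o0add osub0.
have -> : b = ozero by apply/le_anti; rewrite b0 leo0.
by rewrite osub0 oadd0.
Qed.

HB.instance Definition _ := isMonoid.Build (bicyclic alpha) bmulA bmul1x bmulx1.

Lemma bdiag_subproof j (hj : onat j < alpha) :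
  in_wexp alpha (oexp j) && in_wexp alpha (oexp j).
Proof. by rewrite in_wexp_exp. Qed.
Definition bdiag j (hj : onat j < alpha) : bicyclic alpha :=
  @Bicyclic alpha (oexp j, oexp j) (bdiag_subproof hj).

Local Open Scope classical_set_scope.
(* The set U_n at (omega^j, omega^j); only meaningful for 0 < j. *)
Definition bnbhs j (hj : onat j < alpha) (n : nat) : set (bicyclic alpha) :=
  [set x : bicyclic alpha | [/\ x.1 < oexp j, x.2 < oexp j &
               omuln n j.-1 < x.1 \/ omuln n j.-1 < x.2]] `|` [set bdiag hj].

End Bicyclic.

(* [Topological T] is the type of topologies on T. *)
Definition top_space (T : Type) (tau : Topological T) : topologicalType :=
  Topological.Pack tau.

Definition same_topology (T : Type) (tau sigma : Topological T) : Prop :=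
  forall U : set T, @open (top_space tau) U <-> @open (top_space sigma) U.

Definition shift_continuous (S : monoidType) (tau : Topological S) : Prop :=
  forall a b : S, continuous (fun x : top_space tau => (a * x * b)%g : top_space tau).

Local Open Scope classical_set_scope.
(* The properties which determine tau_{i,alpha}, up to [same_topology]. *)
Record is_tau (i alpha : ord) (tau : Topological (bicyclic alpha)) : Prop := {
  tau_locally_compact : locally_compact [set: top_space tau];
  tau_hausdorff : hausdorff_space (top_space tau);
  tau_shift_continuous : shift_continuous tau;
  tau_isolated : forall j (hj : onat j < alpha), i <= onat j ->
    @open (top_space tau) [set bdiag hj];
  tau_nbhs : forall j (hj : onat j < alpha), (0 < j)%N -> onat j < i ->
    nbhs (bdiag hj : top_space tau) =
      filter_from [set n | (0 < n)%N] (bnbhs hj) }.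

(* Main.v *)
(* Write 1 for (0,0) and e_j for (omega^j, omega^j).  The point 1 is isolated,
   its complement being the union of the closed sets {x : e_0 x = x} and
   {x : x e_0 = x}.  Hence the set [up p] of the x above p in the natural order
   is clopen, being the preimage of {1} under x |-> (0,p.1) x (p.2,0).  Near
   p = (a + omega^k, b + omega^k) the topology is the translate of the one near
   e_k, and all other points are isolated; so the neighbourhoods of the e_j
   determine the topology.

   Suppose e_{k+1} is not isolated, with a compact neighbourhood
   K <= up e_{k+1}.  The sets up (m omega^k, l omega^k) cover up e_{k+1} minus
   e_{k+1}, so a compact subset of it is bounded.  Since (c,0) and (0,c)
   fix e_{k+1} on either side for c < omega^{k+1}, K is invariant under these
   shifts outside a bounded set.  Shifting by omega^k moves (m, l) in
   (m omega^k + c, l omega^k + d) through the complement of a square in the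
   grid, which is connected, and the other shifts then reach all c, d.  So K
   has bounded complement, and then so has every neighbourhood of e_{k+1}.
   Moreover K contains a closed copy of up e_k, which is therefore compact;
   for k > 0, were e_k isolated, up e_k minus e_k would be bounded, which it is
   not.  So the isolated e_j with j > 0 form a final segment. *)
Require Import Defs.
From mathcomp Require Import all_boot all_order.
From mathcomp Require Import zify.
From mathcomp Require Import boolp classical_sets filter topology.

Set Implicit Arguments.
Unset Strict Implicit.
Unset Printing Implicit Defensive.

Import Order.TTheory.

Local Open Scope order_scope.
Local Open Scope classical_set_scope.

(** * Ordinal arithmetic: last terms, absorption and division by omega^k *)

Lemma ocoef_add_exp a k l : ocoef (oadd a (oexp k)) l =
  if (l < k)%N then 0 else (ocoef a l + (l == k))%N.
Proof. by rewrite ocoef_add osize_exp ltnS ocoef_exp; case: ltngtP. Qed.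

(* a is a multiple of omega^k. *)
Definition omult k (a : ord) := forall l, (l < k)%N -> ocoef a l = 0.

Lemma ord_last a : a <> ozero ->
  exists k a', a = oadd a' (oexp k) /\ omult k a'.
Proof.
move=> a0.
have ex : exists k, ocoef a k != 0.
  apply: contrapT => h; apply: a0; apply: ocoefP => k; rewrite ocoef0.
  by apply/eqP/negPn/negP => hk; apply: h; exists k.
case: (ex_minnP ex) => k k0 mk.
have z l : (l < k)%N -> ocoef a l = 0.
  by move=> lk; apply/eqP/negPn/negP => /mk; lia.
exists k, (mkord (osize a) (fun l => ocoef a l - (l == k))%N).
split=> [|l lk]; last by rewrite ocoef_mk (z _ lk) if_same.
apply: ocoefP => l; rewrite ocoef_add_exp ocoef_mk.
case: ltnP => [/z //|kl]; case: eqVneq => [->|lk]; first by rewrite osize_gt //; lia.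
by case: ltnP => [|/ocoef_ge ->]; lia.
Qed.

(* omega^k is the last term of the Cantor normal form. *)
Lemma oadd_exp_inj a b k l : oadd a (oexp k) = oadd b (oexp l) -> k = l.
Proof.
move=> e; have /[!ocoef_add_exp] := congr1 (ocoef^~ k) e.
have /[!ocoef_add_exp] := congr1 (ocoef^~ l) e.
by rewrite !ltnn !eqxx; case: ltngtP => //; lia.
Qed.

Lemma omult_add k a b : b <> ozero -> omult k b -> omult k (oadd a b).
Proof.
move=> b0 hb l lk; rewrite ocoef_add hb //.
have kb : (k < osize b)%N.
  rewrite ltnNge; apply/negP => /osize_leP h; apply: b0; apply: ocoefP => m.
  by rewrite ocoef0; case: (ltnP m k) => [/hb|/h].
by case: ifP => //; lia.
Qed.

Lemma oadd_expI k a b : omult k a -> omult k b ->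
  oadd a (oexp k) = oadd b (oexp k) -> a = b.
Proof.
move=> ha hb e; apply: ocoefP => l; case: (ltnP l k) => lk; first by rewrite ha ?hb.
have /[!ocoef_add_exp] := congr1 (ocoef^~ l) e; case: ifP; lia.
Qed.

Lemma oadd_exp_le k a b : omult k b ->
  oadd a (oexp k) = oadd b (oexp k) -> b <= a.
Proof.
move=> hb e; rewrite leNgt; apply/negP => /ltoP[l [hl _]].
case: (ltnP l k) => lk; first by rewrite (hb _ lk) in hl.
by have /[!ocoef_add_exp] := congr1 (ocoef^~ l) e; case: ifP; lia.
Qed.

Lemma oexp_absorb a k : a < oexp k -> oadd a (oexp k) = oexp k.
Proof.
rewrite lt_oexpE => /osize_leP h; apply: ocoefP => l.
by rewrite ocoef_add_exp ocoef_exp; case: ltnP => lk; rewrite ?h //; case: eqVneq lk; lia.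
Qed.

Lemma oadd_lt_exp a b k : a < oexp k -> b < oexp k -> oadd a b < oexp k.
Proof. by rewrite !lt_oexpE osize_add geq_max => -> ->. Qed.

(** omega^j is additively indecomposable: it absorbs every smaller head. *)
Lemma oadd_eq_exp a t j : oadd a t = oexp j ->
  (a = oexp j /\ t = ozero) \/ (a < oexp j /\ t = oexp j).
Proof.
move=> e; have := leo_addr a t; rewrite e le_eqVlt => /orP[/eqP aj|aj].
  by left; split=> //; apply: (@oaddI a); rewrite e oadd0.
by right; split=> //; apply: (@oaddI a); rewrite e oexp_absorb.
Qed.

Lemma omulnS m k : omuln m.+1 k = oadd (omuln m k) (oexp k).
Proof. by []. Qed.

Lemma omuln1 k : omuln 1 k = oexp k.
Proof. by rewrite omulnS o0add. Qed.

Lemma oexp_addmuln m k : oadd (oexp k) (omuln m k) = omuln m.+1 k.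
Proof.
by elim: m => [|m IH]; rewrite ?omuln1 ?oadd0 // omulnS oaddA IH.
Qed.

Lemma leo_muln m n k : (m <= n)%N -> omuln m k <= omuln n k.
Proof.
move=> /subnKC <-; elim: (n - m)%N => [|p IH]; first by rewrite addn0.
by rewrite addnS omulnS; apply: le_trans IH (leo_addr _ _).
Qed.

Lemma lto_muln m n k a : (n < m)%N -> omuln n k < oadd (omuln m k) a.
Proof.
move=> nm; apply: lt_le_trans (leo_addr _ _); apply: lt_le_trans (leo_muln k nm).
rewrite omulnS -{1}(oadd0 (omuln n k)) ltoadd2l.
by apply/ltoP; exists k; split=> [|l kl];
  rewrite ocoef0 ocoef_exp ?eqxx //; case: eqVneq kl; lia.
Qed.

Lemma omuln_lt_exp m k : omuln m k < oexp k.+1.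
Proof.
by rewrite lt_oexpE; apply/osize_leP => l kl; rewrite ocoef_muln; case: eqVneq kl; lia.
Qed.

Lemma lto_exp k l : (k < l)%N -> oexp k < oexp l.
Proof. by rewrite lt_oexpE osize_exp. Qed.

Lemma oexp_gt0 k : ozero < oexp k.
Proof. by rewrite lt_oexpE osize0. Qed.

Lemma ord_divn a k : a < oexp k.+1 ->
  exists m, exists2 a', a' < oexp k & a = oadd (omuln m k) a'.
Proof.
rewrite lt_oexpE => /osize_leP h; exists (ocoef a k), (mkord k (ocoef a)).
  by rewrite lt_oexpE osize_mk.
apply: ocoefP => l; rewrite ocoef_add !ocoef_muln !ocoef_mk.
have := osize_mk k (ocoef a).
case: (ltngtP l k) => [lk|lk|->]; case: ifP => //; try lia.
by move=> _ _; rewrite h.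
Qed.

Lemma omuln_ltE n m k a : a < oexp k -> omuln n k < oadd (omuln m k) a -> (n <= m)%N.
Proof.
move=> ak h; rewrite leqNgt; apply/negP => mn.
have : oadd (omuln m k) a < omuln n k.
  by apply: lt_le_trans (leo_muln k mn); rewrite omulnS ltoadd2l.
by move=> /(lt_trans h); rewrite ltxx.
Qed.

(** * Products with (c, 0) and (0, c) *)

Lemma pmul_left c x : pmul (c, ozero) x = (oadd c x.1, x.2).
Proof. by rewrite /pmul /= leo0 osub0. Qed.

Lemma pmul_right c x : pmul x (ozero, c) = (x.1, oadd c x.2).
Proof.
rewrite /pmul /=; case: leP => [x0|_]; last by rewrite osub0.
have -> : x.2 = ozero by apply/le_anti; rewrite x0 leo0.
by rewrite osub0 !oadd0.
Qed.

Lemma pmul_unleft c a b : pmul (ozero, c) (oadd c a, b) = (a, b).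
Proof. by rewrite /pmul /= leo_addr oaddKl o0add. Qed.

Lemma osubxx a : osub a a = ozero.
Proof. by rewrite -{1}(oadd0 a) oaddKl. Qed.

Lemma pmul_unright c a b : pmul (a, oadd c b) (c, ozero) = (a, b).
Proof.
rewrite /pmul /=; case: leP => [cb|_]; last by rewrite oaddKl o0add.
have b0 : b = ozero.
  apply: (@oaddI c); rewrite oadd0; apply/le_anti; by rewrite cb leo_addr.
by rewrite b0 !oadd0 osubxx oadd0.
Qed.

Lemma pmul_absleft a t b : pmul (ozero, oadd a t) (a, b) = (ozero, oadd b t).
Proof.
rewrite /pmul /=; case: leP => [cb|_]; last by rewrite oaddKl.
have t0 : t = ozero.
  apply: (@oaddI a); rewrite oadd0; apply/le_anti; by rewrite cb leo_addr.
by rewrite t0 !oadd0 osubxx oadd0.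
Qed.

Lemma pmul_absright a b t : pmul (a, b) (oadd b t, ozero) = (oadd a t, ozero).
Proof. by rewrite /pmul /= leo_addr oaddKl. Qed.

Lemma oadd_eq0 a b : oadd a b = ozero -> a = ozero /\ b = ozero.
Proof.
move=> e; have a0 : a = ozero by apply/le_anti; rewrite leo0 andbT -e leo_addr.
by split=> //; rewrite a0 o0add in e.
Qed.

Lemma pmul_right_eq1 a b c : pmul (a, b) (c, ozero) = (ozero, ozero) ->
  a = ozero /\ b = c.
Proof.
case: (leP c b) => [/leo_exists[v ->]|/ltW/leo_exists[v ->]].
  by rewrite pmul_unright => -[-> ->]; rewrite oadd0.
by rewrite pmul_absright => -[/oadd_eq0[-> ->]]; rewrite oadd0.
Qed.

(** * Points of the monoid and their upper sets *)

(** Whatever dominates a point outside the square [0, N]^2 is outside it too; so one climbs from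
    (m0, l0) to a common upper bound and descends to (m, l). *)
Lemma grid_connected (Q : nat -> nat -> Prop) N :
  (forall m l, (N < m \/ N < l)%N -> Q m l -> Q m.+1 l) ->
  (forall m l, (N < m \/ N < l)%N -> Q m l -> Q m l.+1) ->
  (forall m l, (N < m.+1 \/ N < l)%N -> Q m.+1 l -> Q m l) ->
  (forall m l, (N < m \/ N < l.+1)%N -> Q m l.+1 -> Q m l) ->
  forall m0 l0 m l, (N < m0 \/ N < l0)%N -> Q m0 l0 ->
  (N < m \/ N < l)%N -> Q m l.
Proof.
move=> u1 u2 d1 d2 m0 l0 m l h0 q0 h.
have upl p r : Q (m0 + p)%N (l0 + r)%N.
  elim: p => [|p IH]; last by rewrite addnS; apply: u1 => //; lia.
  by rewrite addn0; elim: r => [|r IH]; rewrite ?addn0 // addnS; apply: u2 => //; lia.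
have dn1 p m1 l1 : (N < m1 \/ N < l1)%N -> Q (m1 + p)%N l1 -> Q m1 l1.
  move=> h1; elim: p => [|p IH]; first by rewrite addn0.
  by rewrite addnS => /d1 H; apply/IH/H; lia.
have dn2 p m1 l1 : (N < m1 \/ N < l1)%N -> Q m1 (l1 + p)%N -> Q m1 l1.
  move=> h1; elim: p => [|p IH]; first by rewrite addn0.
  by rewrite addnS => /d2 H; apply/IH/H; lia.
have := upl (m + N.+1)%N (l + N.+1)%N.
rewrite !(addnCA _ m) !(addnCA _ l).
by case: h => h H; [apply: (dn1 (m0 + N.+1)%N); last apply: (dn2 (l0 + N.+1)%N)
  |apply: (dn2 (l0 + N.+1)%N); last apply: (dn1 (m0 + N.+1)%N)] => //; lia.
Qed.

Section Elements.
Variable alpha : ord.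
Local Notation B := (bicyclic alpha).

Lemma in_wexp0 : in_wexp alpha ozero.
Proof. by apply/in_wexpP => k; rewrite ocoef0. Qed.

Lemma in_wexp_lt j a : onat j < alpha -> a < oexp j -> in_wexp alpha a.
Proof.
move=> hj; rewrite lt_oexpE => /osize_leP h; apply/in_wexpP => k k0.
by apply: lt_trans hj; rewrite lt_onat ltnNge; apply: contra k0 => /h ->.
Qed.

Lemma in_wexp_l (x : B) : in_wexp alpha x.1.
Proof. by case: x => -[a b] /= /andP[]. Qed.

Lemma in_wexp_r (x : B) : in_wexp alpha x.2.
Proof. by case: x => -[a b] /= /andP[]. Qed.

Lemma bext (x y : B) : x.1 = y.1 -> x.2 = y.2 -> x = y.
Proof.
move=> e1 e2; apply: val_inj => /=.
by case: (bpair x) (bpair y) e1 e2 => a b [c d] /= -> ->.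
Qed.

(** A total constructor; a pair with an entry out of range falls back to the default 1. *)
Definition bmk (a b : ord) : B := insubd (bone alpha) (a, b).

Lemma bmkE a b : in_wexp alpha a -> in_wexp alpha b -> bmk a b = (a, b) :> ord * ord.
Proof. by move=> ha hb; rewrite -[bpair _]/(val _) val_insubd /= ha hb. Qed.

Lemma bmk_eta (x : B) : bmk x.1 x.2 = x.
Proof. by apply: val_inj; rewrite /= bmkE ?in_wexp_l ?in_wexp_r //; case: (bpair x). Qed.

Lemma translateE a b (x : B) : in_wexp alpha a -> in_wexp alpha b ->
  (bmk a ozero * x * bmk ozero b)%g = (oadd a x.1, oadd b x.2) :> ord * ord.
Proof.
by move=> ha hb; rewrite /= !bmkE ?in_wexp0 // pmul_left pmul_right.
Qed.

Lemma translateK a b (x : B) : in_wexp alpha a -> in_wexp alpha b ->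
  (bmk ozero a * (bmk a ozero * x * bmk ozero b) * bmk b ozero)%g = x.
Proof.
move=> ha hb; move: (bmk a ozero * x * _)%g (translateE x ha hb) => y yE.
by apply: bext; rewrite /= yE !bmkE ?in_wexp0 // pmul_unleft pmul_unright.
Qed.

(** In terms of [pact], these elements are the partial maps extending that of p: the natural order
    of an inverse monoid. *)
Definition up (p : ord * ord) : set B :=
  [set x : B | exists t, oadd x.1 t = p.1 /\ oadd x.2 t = p.2].

(** If x.1 + t = a, the left factor turns x into (0, x.2 + t), and (b, 0) then gives 1 only when x.2
    + t = b. If a < x.1, a non-zero first coordinate remains. *)
Lemma upE a b : in_wexp alpha a -> in_wexp alpha b ->
  up (a, b) = [set x : B | (bmk ozero a * x * bmk b ozero)%g = bone alpha].
Proof.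
move=> ha hb; apply/seteqP; split=> [[[x y] w] [t /= [ea eb]]|x /=].
  apply: val_inj; rewrite /= !bmkE ?in_wexp0 // -ea pmul_absleft eb.
  by rewrite -{1}(oadd0 b) pmul_unright.
move=> /(congr1 (@bpair alpha)); rewrite /= !bmkE ?in_wexp0 //.
case: x => -[x y] w /=; case e : (pmul _ (x, y)) => [u v] /pmul_right_eq1[u0 vb].
subst u v; rewrite /up /=.
case: (leP a x) e => [/leo_exists[s ->]|/ltW/leo_exists[t ->]].
  by rewrite pmul_unleft => -[-> ->]; exists ozero; rewrite !oadd0.
by rewrite pmul_absleft => -[<-]; exists t.
Qed.

(** By indecomposability each coordinate forces the shared tail t to be 0 or omega^j; the mixed
    cases contradict each other. *)
Lemma up_exp j (hj : onat j < alpha) (x : B) :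
  up (oexp j, oexp j) x <-> (x.1 < oexp j /\ x.2 < oexp j) \/ x = bdiag hj.
Proof.
split=> [[t [/oadd_eq_exp[[x1 ->]|[x1 tj]] /oadd_eq_exp[[x2 t0]|[x2 t0]]]]|].
- by right; apply: bext.
- by have := oexp_gt0 j; rewrite -t0 ltxx.
- by have := oexp_gt0 j; rewrite -tj t0 ltxx.
- by left.
case=> [[x1 x2]|->]; first by exists (oexp j); rewrite !oexp_absorb.
by exists ozero; rewrite !oadd0.
Qed.

Lemma up_self (x : B) : up x x.
Proof. by exists ozero; rewrite !oadd0. Qed.

(* The condition defining [bnbhs] at omega^(k+1). *)
Definition far N k (a b : ord) := omuln N k < a \/ omuln N k < b.

Lemma far_le M N k a b : (N <= M)%N -> far M k a b -> far N k a b.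
Proof.
by move=> /(leo_muln k) h [] /(le_lt_trans h); [left|right].
Qed.

Lemma up_not_far k m l (x : B) :
  up (omuln m k, omuln l k) x -> ~ far (maxn m l) k x.1 x.2.
Proof.
move=> [t /= [e1 e2]] [] /(le_lt_trans (leo_muln k _)).
  by move=> /(_ m (leq_maxl _ _)); rewrite -e1 ltNge leo_addr.
by move=> /(_ l (leq_maxr _ _)); rewrite -e2 ltNge leo_addr.
Qed.

Lemma near_up k (x : B) : x.1 < oexp k.+1 -> x.2 < oexp k.+1 ->
  exists m l, up (omuln m.+1 k, omuln l.+1 k) x /\
    forall N, ~ far N k x.1 x.2 -> (m <= N)%N /\ (l <= N)%N.
Proof.
move=> /ord_divn[m [a ha e1]] /ord_divn[l [b hb e2]]; exists m, l.
split=> [|N nf].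
  (* The tail omega^k absorbs both remainders, hence the successors of m and l. *)
  by exists (oexp k); rewrite e1 e2 -(oaddA _ a) -(oaddA _ b)
    (oexp_absorb ha) (oexp_absorb hb).
split; rewrite leqNgt; apply/negP => h; apply: nf; rewrite /far e1 e2.
  by left; apply: lto_muln.
by right; apply: lto_muln.
Qed.

Lemma in_wexp_add_exp k a : omult k a -> in_wexp alpha (oadd a (oexp k)) ->
  in_wexp alpha a /\ onat k < alpha.
Proof.
move=> ha /in_wexpP h; split; last by apply: h; rewrite ocoef_add_exp ltnn eqxx addn1.
apply/in_wexpP => l l0; apply: h; rewrite ocoef_add_exp.
by case: ltnP => [/ha al|_]; [rewrite al in l0|rewrite addn_eq0 negb_and l0].
Qed.

(* On this neighbourhood of (a + omega^k, b + omega^k) the translation by (a, b)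
   has the inverse x |-> (0,a) x (b,0). *)
Lemma up_window k a b (y : B) : omult k a -> omult k b ->
  up (oadd a (oexp k), oadd b (oexp k)) y -> ~ up (a, b) y ->
  a <= y.1 /\ b <= y.2.
Proof.
move=> ha hb [t [/= e1 e2]] nu.
have [t0|/ord_last[m [s [te hs]]]] := pselect (t = ozero).
  by rewrite t0 !oadd0 in e1 e2; rewrite e1 e2 !leo_addr.
rewrite te !oaddA in e1 e2; have mk := oadd_exp_inj e1; subst m.
have [s0|s0] := pselect (s = ozero).
  by rewrite s0 !oadd0 in e1 e2; split; [apply: oadd_exp_le e1|apply: oadd_exp_le e2].
(* With s non-zero, y.1 + s and y.2 + s are multiples of omega^k, so the final omega^k cancels and y
   lies above (a, b). *)
by case: nu; exists s; split; apply: oadd_expI e1 + apply: oadd_expI e2;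
  rewrite //; apply: omult_add.
Qed.

(** A non-zero common tail would end both coordinates in the same power of omega. *)
Lemma up_trivial (x y : B) : up x y ->
  (forall a k b l, x.1 = oadd a (oexp k) -> x.2 = oadd b (oexp l) -> k <> l) ->
  y = x.
Proof.
move=> [t [e1 e2]] h; have [t0|/ord_last[m [s [te _]]]] := pselect (t = ozero).
  by rewrite t0 !oadd0 in e1 e2; apply: bext.
by case: (h (oadd y.1 s) m (oadd y.2 s) m); rewrite -?oaddA -?te.
Qed.

End Elements.
Arguments bmk {alpha}.
Arguments up {alpha}.

(** * Shift-continuous topologies *)

Section Topology.
Variables (alpha : ord) (tau : Topological (bicyclic alpha)).
Hypothesis alpha_gt0 : onat 0 < alpha.
Hypothesis T2 : hausdorff_space (top_space tau).
Hypothesis sc : shift_continuous tau.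
Local Notation B := (bicyclic alpha).
Local Notation T := (top_space tau).

Lemma shift_nbhs (a b : B) (x : T) (A : set T) :
  nbhs ((a * x * b)%g : T) A -> nbhs x [set y : T | A (a * y * b)%g].
Proof. exact: sc. Qed.

Lemma shift_open (a b : B) (A : set T) :
  open A -> open [set y : T | A (a * y * b)%g].
Proof. by have /continuousP := @sc a b; apply. Qed.

Lemma closed_shift_fix (a b : B) : closed [set x : T | (a * x * b)%g = x].
Proof.
move=> x cl /=; apply/esym/T2 => P Q Px /shift_nbhs Qx.
have [y [/= e [Py]]] := cl _ (filterI Px Qx).
by move: e => /= -> Qy; exists y.
Qed.

Lemma open_bone : open ([set bone alpha] : set T).
Proof.
have w1 : in_wexp alpha (oexp 0) by apply: in_wexp_exp.
pose e : B := bmk (oexp 0) (oexp 0).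
have eE : e = (oexp 0, oexp 0) :> ord * ord by rewrite bmkE.
(* The left shift by e fixes x exactly when 1 <= x.1, the right one exactly when 1 <= x.2. *)
have -> : [set bone alpha] =
    ~` ([set x : T | (e * x * 1)%g = x] `|` [set x : T | (1 * x * e)%g = x]).
  apply/seteqP; split=> [_ -> []|].
  - move=> /(congr1 (@bpair alpha)); rewrite mulg1 /= eE /pmul /= leNgt oexp_gt0 /=.
    by case=> e0; have := oexp_gt0 0; rewrite e0 ltxx.
  - move=> /(congr1 (@bpair alpha)); rewrite mul1g /= eE /pmul /= leo0 o0add.
    by case=> _ e0; have := oexp_gt0 0; rewrite [oexp 0]e0 ltxx.
  move=> x /not_orP[/= h1 h2].
  case: (ltP x.1 (oexp 0)) => x1; last first.
    case: h1; apply: bext; rewrite mulg1 /= eE /pmul /= x1 //=.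
    by rewrite osubK.
  case: (ltP x.2 (oexp 0)) => x2; last first.
    case: h2; apply: bext; rewrite mul1g /= eE /pmul /=; case: leP => //= x2'.
    - have -> : x.2 = oexp 0 by apply/le_anti; rewrite x2 x2'.
      by rewrite osubxx oadd0.
    - by apply/le_anti; rewrite x2 x2'.
    - by rewrite osubK.
  by move: x1 x2 => /lt_oexp0 x1 /lt_oexp0 x2; apply: bext.
by apply: closed_openC; apply: closedU; apply: closed_shift_fix.
Qed.

Lemma closed1 (x : T) : closed [set x].
Proof. exact/accessible_closed_set1/hausdorff_accessible. Qed.

Lemma open_up a b : in_wexp alpha a -> in_wexp alpha b -> open (up (a, b) : set T).
Proof. by move=> ha hb; rewrite upE //; apply: (shift_open _ _ open_bone). Qed.

Lemma closed_up a b : in_wexp alpha a -> in_wexp alpha b -> closed (up (a, b) : set T).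
Proof.
move=> ha hb; rewrite upE //.
have /continuous_closedP h := @sc (bmk ozero a) (bmk b ozero).
exact: (h [set bone alpha] (@closed1 (bone alpha))).

Qed.

Lemma in_wexp_muln m k : onat k.+1 < alpha -> in_wexp alpha (omuln m k).
Proof. by move=> hk; apply: in_wexp_lt hk (omuln_lt_exp _ _). Qed.

(** * Compact neighbourhoods of e_{k+1} *)

Section Level.
Variable k : nat.
Hypothesis hk : onat k.+1 < alpha.
Local Notation e := (bdiag hk).

(** Finitely many closed sets, [up] of (m omega^k, l omega^k) for 1 <= m, l <= n + 1, are removed
    from an open one; by [near_up] they cover the pairs below omega^(k+1) that are not far. *)
Lemma nbhs_bnbhs n : nbhs (e : T) (bnbhs hk n).
Proof.
pose V (i : 'I_n.+1 * 'I_n.+1) : set T :=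
  ~` (up (omuln i.1.+1 k, omuln i.2.+1 k) : set T).
have nV i : nbhs (e : T) (V i).
  apply: open_nbhs_nbhs; split.
    by apply: closed_openC; apply: closed_up; apply: in_wexp_muln.
  move=> [t [h _]]; have : oexp k.+1 <= omuln i.1.+1 k.
    by rewrite -[omuln _ _]h leo_addr.
  by rewrite leNgt omuln_lt_exp.
have nU : nbhs (e : T) (up (oexp k.+1, oexp k.+1) : set T).
  apply: open_nbhs_nbhs; split; last by apply/(up_exp hk); right.
  by apply: open_up; apply: in_wexp_exp.
apply: filterS (filterI nU (filter_forall _ nV)) => x [].
move=> /(up_exp hk)[[x1 x2]|->]; last by right.
move=> hV; left; split=> //; apply: contrapT => nf.
have [m [l [h /(_ _ nf)[mn ln]]]] := near_up x1 x2.
by apply: (hV (Ordinal (mn : (m < n.+1)%N), Ordinal (ln : (l < n.+1)%N))).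
Qed.

(** Otherwise the sets [A n] generate a proper filter with a cluster point p in K. Here p = e is
    excluded by O, and any other p has an open neighbourhood [up] without far points for a large
    index. *)
Lemma compact_bounded (K O : set T) : compact K ->
  K `<=` up (oexp k.+1, oexp k.+1) -> nbhs (e : T) O ->
  exists N, forall x : B, K x -> far N k x.1 x.2 -> O x.
Proof.
move=> cK Ku nO; apply: contrapT => hN.
pose A n : set T := [set x : B | [/\ K x, far n k x.1 x.2 & ~ O x]].
have FF : ProperFilter (filter_from [set: nat] A).
  apply: filter_from_proper => [|n _].
    apply: filter_from_filter; first by exists 0.
    move=> i j _ _; exists (maxn i j) => // x [Kx fx nx].
    by split; split=> //; apply: far_le fx; rewrite ?leq_maxl ?leq_maxr.
  apply: contrapT => hA; apply: hN; exists n => x Kx fx.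
  by apply: contrapT => nx; apply: hA; exists x.
have [|p [Kp clp]] := cK _ FF; first by exists 0 => // x [].
have [[p1 p2]|pe] := (up_exp hk _).1 (Ku _ Kp); last first.
  have [||x [[_ _ nx] Ox]] := clp (A 0) O; [by exists 0|by rewrite pe|].
  exact: nx.
have [m [l [pV _]]] := near_up p1 p2.
have [||x [[_ fx _] xV]] := clp (A (maxn m.+1 l.+1)) (up (omuln m.+1 k, omuln l.+1 k)).
- by exists (maxn m.+1 l.+1).
- by apply: open_nbhs_nbhs; split=> //; apply: open_up; apply: in_wexp_muln.
exact: up_not_far xV fx.
Qed.

Variable K : set T.
Hypothesis cK : compact K.
Hypothesis Ku : K `<=` up (oexp k.+1, oexp k.+1).
Hypothesis nK : nbhs (e : T) K.

(** The preimage of K under a shift fixing e is again a neighbourhood of e. *)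
Lemma shift_far (a b : B) : (a * e * b)%g = e ->
  exists N, forall x : B, K x -> far N k x.1 x.2 -> K (a * x * b)%g.
Proof.
move=> abe; apply: (compact_bounded cK Ku).
by apply: (@shift_nbhs a b e K); rewrite abe.
Qed.

Lemma in_wexp_ltk a : a < oexp k.+1 -> in_wexp alpha a.
Proof. exact: in_wexp_lt. Qed.

(** As omega^(k+1) absorbs c, the shifts by (c, 0) and (0, c) fix e. The last clause is the left
    shift by (0, c) at a first coordinate a <= c: it wipes out a and hands the rest of c to the
    second coordinate. *)
Lemma shifts_far c : c < oexp k.+1 -> exists N, forall a b,
  a < oexp k.+1 -> b < oexp k.+1 ->
  [/\ far N k a b -> K (bmk a b) -> K (bmk (oadd c a) b),
      far N k a b -> K (bmk a b) -> K (bmk a (oadd c b)),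
      far N k (oadd c a) b -> K (bmk (oadd c a) b) -> K (bmk a b),
      far N k a (oadd c b) -> K (bmk a (oadd c b)) -> K (bmk a b) &
      forall t, c = oadd a t -> far N k a b -> K (bmk a b) ->
        K (bmk ozero (oadd b t))].
Proof.
move=> hc; have w0 := in_wexp0 alpha; have wc := in_wexp_ltk hc.
have we : in_wexp alpha (oexp k.+1) by apply: in_wexp_exp.
have e1 : oadd c (oexp k.+1) = oexp k.+1 by apply: oexp_absorb.
have [|N1 h1] := @shift_far (bmk c ozero) 1%g.
  by apply: val_inj; rewrite mulg1 /= bmkE // pmul_left /= e1.
have [|N2 h2] := @shift_far 1%g (bmk ozero c).
  by apply: val_inj; rewrite mul1g /= bmkE // pmul_right /= e1.
have [|N3 h3] := @shift_far (bmk ozero c) 1%g.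
  by apply: val_inj; rewrite mulg1 /= bmkE // -{1}e1 pmul_unleft.
have [|N4 h4] := @shift_far 1%g (bmk c ozero).
  by apply: val_inj; rewrite mul1g /= bmkE // -{2}e1 pmul_unright.
exists (maxn (maxn N1 N2) (maxn N3 N4)) => a b ha hb.
have wa := in_wexp_ltk ha; have wb := in_wexp_ltk hb.
have wca := in_wexp_add wc wa; have wcb := in_wexp_add wc wb.
split=> [f Kab|f Kab|f Kab|f Kab|t ct f Kab].
- have := h1 (bmk a b) Kab; rewrite mulg1 bmkE //.
  have -> : (bmk c ozero * bmk a b)%g = bmk (oadd c a) b :> B.
    by apply: val_inj; rewrite /= !bmkE // pmul_left.
  by apply; apply: far_le f; rewrite !leq_max leqnn ?orbT.
- have := h2 (bmk a b) Kab; rewrite mul1g bmkE //.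
  have -> : (bmk a b * bmk ozero c)%g = bmk a (oadd c b) :> B.
    by apply: val_inj; rewrite /= !bmkE // pmul_right.
  by apply; apply: far_le f; rewrite !leq_max leqnn ?orbT.
- have := h3 _ Kab; rewrite mulg1 bmkE //.
  have -> : (bmk ozero c * bmk (oadd c a) b)%g = bmk a b :> B.
    by apply: val_inj; rewrite /= !bmkE // pmul_unleft.
  by apply; apply: far_le f; rewrite !leq_max leqnn ?orbT.
- have := h4 _ Kab; rewrite mul1g bmkE //.
  have -> : (bmk a (oadd c b) * bmk c ozero)%g = bmk a b :> B.
    by apply: val_inj; rewrite /= !bmkE // pmul_unright.
  by apply; apply: far_le f; rewrite !leq_max leqnn ?orbT.
- have := h3 _ Kab; rewrite mulg1 bmkE //.
  have wt : in_wexp alpha t.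
    by rewrite -(oaddKl a t) -ct; apply: in_wexp_sub; rewrite // ct leo_addr.
  have -> : (bmk ozero c * bmk a b)%g = bmk ozero (oadd b t) :> B.
    by apply: val_inj; rewrite /= !bmkE ?in_wexp_add // ct pmul_absleft.
  by apply; apply: far_le f; rewrite !leq_max leqnn ?orbT.
Qed.

Lemma oexp_muln_lt m c : c < oexp k -> oadd (omuln m k) c < oexp k.+1.
Proof.
move=> ck; apply: oadd_lt_exp; first exact: omuln_lt_exp.
exact: lt_trans ck (lto_exp (ltnSn k)).
Qed.

Lemma far_muln N m l c d : (N < m)%N \/ (N < l)%N ->
  far N k (oadd (omuln m k) c) (oadd (omuln l k) d).
Proof. by move=> [] h; [left|right]; apply: lto_muln. Qed.

(** Only shifts by omega^k are used, and they change the quotients m and l whatever the remainders;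
    so one N serves all c and d. *)
Lemma column_grid : exists N, forall c d, c < oexp k -> d < oexp k ->
  forall m0 l0 m l, (N < m0)%N \/ (N < l0)%N ->
  K (bmk (oadd (omuln m0 k) c) (oadd (omuln l0 k) d)) ->
  (N < m)%N \/ (N < l)%N ->
  K (bmk (oadd (omuln m k) c) (oadd (omuln l k) d)).
Proof.
have [N hN] := shifts_far (lto_exp (ltnSn k)); exists N => c d ck dk.
apply: (@grid_connected (fun m l =>
  K (bmk (oadd (omuln m k) c) (oadd (omuln l k) d)))) => m l h.
all: have [s1 s2 s3 s4 _] := hN _ _ (oexp_muln_lt m ck) (oexp_muln_lt l dk).
all: move: s1 s2 s3 s4; rewrite !oaddA !oexp_addmuln => s1 s2 s3 s4.
- exact/s1/far_muln.
- exact/s2/far_muln.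
- exact/s3/far_muln.
- exact/s4/far_muln.
Qed.

(** Some far point lies in K because e is not isolated. Its remainders are first reduced to 0 and
    then replaced by arbitrary ones, each change being made far out in the grid. *)
Lemma far_subset : ~ open ([set e] : set T) ->
  exists N, forall x : B, x.1 < oexp k.+1 -> x.2 < oexp k.+1 ->
    far N k x.1 x.2 -> K x.
Proof.
move=> ni; have [N hN] := column_grid.
have k0 := oexp_gt0 k; have kk := lto_exp (ltnSn k).
(* Index N + 1 and not N: a pair can be far for N through a remainder alone, with quotients still at
   most N. *)
have [x [[x1 x2 fx] Kx]] : exists x : B, [/\ x.1 < oexp k.+1, x.2 < oexp k.+1 &
    far N.+1 k x.1 x.2] /\ K x.
  apply: contrapT => nx; apply: ni; rewrite openE => _ ->.
  apply: filterS (filterI (nbhs_bnbhs N.+1) nK) => x [[h|//] Kx].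
  by case: nx; exists x.
have [m0 [l0 [c [d [ck dk h0 Q0]]]]] : exists m l c d,
    [/\ c < oexp k, d < oexp k, (N < m)%N \/ (N < l)%N &
     K (bmk (oadd (omuln m k) c) (oadd (omuln l k) d))].
  move: x1 x2 => /ord_divn[m [c ck e1]] /ord_divn[l [d dk e2]].
  exists m, l, c, d; rewrite -e1 -e2 bmk_eta; split=> //.
  by case: fx; rewrite ?e1 ?e2; [move/(omuln_ltE ck); left|move/(omuln_ltE dk); right].
have P00 m l : (N < m)%N \/ (N < l)%N ->
    K (bmk (oadd (omuln m k) ozero) (oadd (omuln l k) ozero)).
  have [M hM] := shifts_far kk.
  pose L := maxn N.+1 M.+1.
  have [NL ML] : (N < L)%N /\ (M < L)%N by rewrite !leq_max !leqnn orbT.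
  apply: (hN _ _ k0 k0 0 L.+1); first by right; apply: leqW.
  (* As omega^k = c + omega^k, the shift by (0, omega^k) replaces c by 0, and the omega^k handed
     over absorbs d. *)
  have [_ _ _ _ s5] := hM _ _ (oexp_muln_lt 0 ck) (oexp_muln_lt L dk).
  rewrite (oadd0 (omuln 0 k)).
  have -> : oadd (omuln L.+1 k) ozero = oadd (oadd (omuln L k) d) (oexp k).
    by rewrite oadd0 -oaddA (oexp_absorb dk).
  apply: s5; first by rewrite o0add (oexp_absorb ck).
    by apply: far_muln; right.
  by apply: (hN _ _ ck dk m0 l0) => //; right.
have Pc0 a m l : a < oexp k -> (N < m)%N \/ (N < l)%N ->
    K (bmk (oadd (omuln m k) a) (oadd (omuln l k) ozero)).
  (* M depends on a; L exceeds it, and [hN], whose N is uniform, brings the result back to all (m,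
     l). *)
  move=> ak; have [M hM] := shifts_far (lt_trans ak kk).
  pose L := maxn N.+1 M.+1.
  have [NL ML] : (N < L)%N /\ (M < L)%N by rewrite !leq_max !leqnn orbT.
  (* The quotient next to a is 0, since a positive multiple of omega^k would absorb a. *)
  apply: (hN _ _ ak k0 0 L); first by right.
  have [s1 _ _ _ _] := hM _ _ (oexp_muln_lt 0 k0) (oexp_muln_lt L k0).
  have -> : oadd (omuln 0 k) a = oadd a (oadd (omuln 0 k) ozero).
    by rewrite o0add !oadd0.
  by apply: s1; [apply: far_muln|apply: P00]; right.
have Pcd a b m l : a < oexp k -> b < oexp k -> (N < m)%N \/ (N < l)%N ->
    K (bmk (oadd (omuln m k) a) (oadd (omuln l k) b)).
  move=> ak bk; have [M hM] := shifts_far (lt_trans bk kk).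
  pose L := maxn N.+1 M.+1.
  have [NL ML] : (N < L)%N /\ (M < L)%N by rewrite !leq_max !leqnn orbT.
  apply: (hN _ _ ak bk L 0); first by left.
  have [_ s2 _ _ _] := hM _ _ (oexp_muln_lt L ak) (oexp_muln_lt 0 k0).
  have -> : oadd (omuln 0 k) b = oadd b (oadd (omuln 0 k) ozero).
    by rewrite o0add !oadd0.
  by apply: s2; [apply: far_muln|apply: Pc0 => //]; left.
exists N.+1 => y; move=> /ord_divn[m [a ak e1]] /ord_divn[l [b bk e2]] fy.
rewrite -(bmk_eta y) e1 e2; apply: Pcd => //.
by case: fy; rewrite ?e1 ?e2; [move/(omuln_ltE ak) ; left|move/(omuln_ltE bk) ; right].
Qed.

End Level.

(** Above e_0 there are only e_0 and 1, because 0 is the only ordinal below omega^0. *)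
Lemma open_bdiag0 : open ([set bdiag alpha_gt0] : set T).
Proof.
have -> : [set bdiag alpha_gt0] = up (oexp 0, oexp 0) `&` ~` [set bone alpha] :> set T.
  apply/seteqP; split=> [_ ->|x [/(up_exp alpha_gt0)[[/lt_oexp0 x1 /lt_oexp0 x2]|//] []]].
    split; first by apply/(up_exp alpha_gt0); right.
    move=> /(congr1 (fun x : B => x.1)) /= e0.
    by have := oexp_gt0 0; rewrite [oexp 0]e0 ltxx.
  exact: bext.
have w0 : in_wexp alpha (oexp 0) by apply: in_wexp_exp.
exact: openI (open_up w0 w0) (closed_openC (@closed1 (bone alpha))).
Qed.

Lemma open_isolated (x : B) :
  (forall a k b l, x.1 = oadd a (oexp k) -> x.2 = oadd b (oexp l) -> k <> l) ->
  open ([set x] : set T).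
Proof.
move=> h; have -> : [set x] = up (x.1, x.2).
  apply/seteqP; split=> [_ ->|y]; first exact: up_self.
  by move=> /up_trivial; apply.
by apply: open_up; rewrite ?in_wexp_l ?in_wexp_r.
Qed.

(** * Local compactness: neighbourhood bases and the spread of isolation *)

Hypothesis lc : locally_compact [set: T].

Section Base.
Variable k : nat.
Hypothesis hk : onat k.+1 < alpha.
Local Notation e := (bdiag hk).

Lemma compact_nbhs : exists K : set T,
  [/\ compact K, K `<=` up (oexp k.+1, oexp k.+1) & nbhs (e : T) K].
Proof.
have we : in_wexp alpha (oexp k.+1) by apply: in_wexp_exp.
have ue : up (oexp k.+1, oexp k.+1) e by apply/(up_exp hk); right.
have [U] := @lc (e : T) I; rewrite withinET => nU [cU clU].
exists (U `&` up (oexp k.+1, oexp k.+1)); split; last 1 first.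
- exact: filterI nU (open_nbhs_nbhs (conj (open_up we we) ue)).
- exact: subclosed_compact (closedI clU (closed_up we we)) cU (@subIsetl _ _ _).
- exact: subIsetr.
Qed.

Lemma nbhs_nonisolated : ~ open ([set e] : set T) ->
  nbhs (e : T) = filter_from [set n | (0 < n)%N] (bnbhs hk).
Proof.
move=> ni; have [K [cK Ku nK]] := compact_nbhs.
have [N hN] := far_subset cK Ku nK ni.
apply/seteqP; split=> [U nU|U [n _ nU]]; last exact: filterS nU (nbhs_bnbhs hk n).
have [M hM] := compact_bounded cK Ku nU.
(* N serves [hN] and M serves [hM]; the successor makes the index positive. *)
exists (maxn N M).+1 => // x [[x1 x2 f]|->]; last exact: nbhs_singleton nU.
have {}f : far (maxn N M) k x.1 x.2 by apply: far_le f.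
by apply: hM; [apply: hN|] => //; apply: far_le f; rewrite leq_max leqnn ?orbT.
Qed.

End Base.

Lemma isolated_next k (hk : onat k.+1 < alpha) (hk2 : onat k.+2 < alpha) :
  open ([set bdiag hk] : set T) -> open ([set bdiag hk2] : set T).
Proof.
move=> io; apply: contrapT => ni; have [K [cK Ku nK]] := compact_nbhs hk2.
have [N hN] := far_subset cK Ku nK ni.
(* Translation by (c, c) moves [u] into the far region, which K contains by [hN]. *)
pose u : set T := up (oexp k.+1, oexp k.+1); pose c := omuln N.+1 k.+1.
have w0 := in_wexp0 alpha; have we : in_wexp alpha (oexp k.+1) by apply: in_wexp_exp.
have wc : in_wexp alpha c by apply: in_wexp_muln.
pose f (x : B) : B := (bmk c ozero * x * bmk ozero c)%g.
pose g (x : B) : B := (bmk ozero c * x * bmk c ozero)%g.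
have fE x : f x = (oadd c x.1, oadd c x.2) :> ord * ord.
  exact: translateE.
have gf x : g (f x) = x by apply: translateK.
have uc : closed u by apply: closed_up.
(* The image of [u] under [f], written so that closedness is visible. *)
pose C : set T := [set x | u (g x)] `&` [set x | f (g x) = x].
have cC : closed C.
  apply: closedI.
    have /continuous_closedP h := @sc (bmk ozero c) (bmk c ozero).
    exact: h.
  have fgE x : f (g x) =
      ((bmk c ozero * bmk ozero c) * x * (bmk c ozero * bmk ozero c))%g.
    by rewrite /f /g !mulgA.
  under eq_set do rewrite fgE.
  exact: closed_shift_fix.
have CK : C `<=` K.
  move=> x [/(up_exp hk) gx fgx].
  have [x1 x2] : (g x).1 < oexp k.+2 /\ (g x).2 < oexp k.+2.
    have kk := lto_exp (ltnSn k.+1).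
    by case: gx => [[h1 h2]|->] //; split; apply: lt_trans kk.
  rewrite -fgx; apply: hN; rewrite fE /=.
  - by apply: oadd_lt_exp => //; apply: omuln_lt_exp.
  - by apply: oadd_lt_exp => //; apply: omuln_lt_exp.
  - by left; apply: lto_muln.
have cu : compact u.
  have -> : u = g @` C.
    apply/seteqP; split=> [x ux|_ [x [ux _] <-]//].
    by exists (f x); rewrite ?gf // /C /=; rewrite gf.
  apply: continuous_compact; last exact: subclosed_compact cC cK CK.
  by apply: continuous_subspaceT; apply: (@sc (bmk ozero c) (bmk c ozero)).
have ne : nbhs (bdiag hk : T) [set bdiag hk] by apply: open_nbhs_nbhs.
have [M hM] := compact_bounded cu (fun=> id) ne.
(* The pair (0, (M+1) omega^k) lies in [u] beyond the bound M but differs from e_{k+1}. *)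
have wM : in_wexp alpha (omuln M.+1 k) by apply: in_wexp_muln.
have := hM (bmk ozero (omuln M.+1 k)); rewrite bmkE // => h.
have /(congr1 (fun x : B => x.1)) : bmk ozero (omuln M.+1 k) = bdiag hk.
  apply: h; last by right; rewrite -(oadd0 (omuln M.+1 k)); apply: lto_muln.
  apply/(up_exp hk); left; rewrite bmkE //.
  by split; [apply: oexp_gt0|apply: omuln_lt_exp].
by rewrite bmkE //= => e0; have := oexp_gt0 k.+1; rewrite [oexp _](esym e0) ltxx.
Qed.

End Topology.

(** * Comparison of topologies through the points e_j *)

Lemma nbhs_transfer (alpha : ord) (tau sigma : Topological (bicyclic alpha)) :
  onat 0 < alpha -> shift_continuous tau ->
  hausdorff_space (top_space sigma) -> shift_continuous sigma ->
  (forall j (hj : onat j < alpha) V,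
    nbhs (bdiag hj : top_space tau) V -> nbhs (bdiag hj : top_space sigma) V) ->
  forall (x : bicyclic alpha) V,
    nbhs (x : top_space tau) V -> nbhs (x : top_space sigma) V.
Proof.
move=> al sct T2s scs H x V nV.
have w0 := in_wexp0 alpha.
(* Covers the points with a zero coordinate or with different last exponents. *)
have iso : (forall a k b l, x.1 = oadd a (oexp k) -> x.2 = oadd b (oexp l) -> k <> l) ->
    nbhs (x : top_space sigma) V.
  move=> /(open_isolated al T2s scs) o.
  have xs : [set x] `<=` V by move=> _ ->; apply: nbhs_singleton nV.
  by apply: filterS xs _; apply: open_nbhs_nbhs.
have nz a k : ozero <> oadd a (oexp k).
  by move=> /esym/oadd_eq0[_ e]; have := oexp_gt0 k; rewrite e ltxx.
have [x1|/ord_last[k [a [xa ha]]]] := pselect (x.1 = ozero).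
  by apply: iso => a k b l; rewrite x1 => /nz.
have [x2|/ord_last[l [b [xb hb]]]] := pselect (x.2 = ozero).
  by apply: iso => c m b l _; rewrite x2 => /nz.
have [kl|kl] := eqVneq k l; last first.
  apply: iso => c m d n; rewrite xa xb => /oadd_exp_inj <- /oadd_exp_inj <-.
  exact/eqP.
subst l.
have [wa hk] : in_wexp alpha a /\ onat k < alpha.
  by apply: in_wexp_add_exp ha _; rewrite -xa in_wexp_l.
have [wb _] : in_wexp alpha b /\ onat k < alpha.
  by apply: in_wexp_add_exp hb _; rewrite -xb in_wexp_r.
pose f (y : bicyclic alpha) : bicyclic alpha := (bmk a ozero * y * bmk ozero b)%g.
pose g (y : bicyclic alpha) : bicyclic alpha := (bmk ozero a * y * bmk b ozero)%g.
have fE y : f y = (oadd a y.1, oadd b y.2) :> ord * ord.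
  exact: translateE.
have gf y : g (f y) = y by apply: translateK.
have fe : f (bdiag hk) = x by apply: bext; rewrite fE.
have ge : g x = bdiag hk by rewrite -fe gf.
(* V is pulled back along [f] in tau, carried to sigma at e_k by [H], then pulled back along [g] in
   sigma. *)
have n1 : nbhs (bdiag hk : top_space sigma) [set y | V (f y)].
  by apply: H; apply: (shift_nbhs sct); rewrite -[(_ * _)%g]/(f (bdiag hk)) fe.
have n2 : nbhs (x : top_space sigma) [set y | V (f (g y))].
  apply: (@shift_nbhs _ _ scs _ _ x [set y | V (f y)]).
  by rewrite -[(_ * _)%g]/(g x) ge.
(* On [U] both a <= y.1 and b <= y.2 hold, so that f (g y) = y. *)
pose U : set (top_space sigma) := up (x.1, x.2) `&` ~` up (a, b).
have nU : nbhs (x : top_space sigma) U.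
  apply: open_nbhs_nbhs; split.
    apply: openI; first by apply: open_up; rewrite ?in_wexp_l ?in_wexp_r.
    by apply: closed_openC; apply: closed_up.
  split; first exact: up_self.
  move=> [t /= [e1 _]]; have := leo_addr x.1 t.
  rewrite e1 xa leNgt -{1}(oadd0 a) ltoadd2l oexp_gt0 //.
apply: filterS (filterI n2 nU) => y [/= Vy [uy nuy]].
rewrite xa xb in uy; have [/leo_exists[s ys] /leo_exists[t yt]] := up_window ha hb uy nuy.
suff yE : f (bmk s t) = y by rewrite -yE gf yE in Vy.
have ws : in_wexp alpha s.
  rewrite -(oaddKl a s) -ys.
  by apply: in_wexp_sub; rewrite ?in_wexp_l // ys leo_addr.
have wt : in_wexp alpha t.
  rewrite -(oaddKl b t) -yt.
  by apply: in_wexp_sub; rewrite ?in_wexp_r // yt leo_addr.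
by apply: bext; rewrite fE bmkE.
Qed.

Lemma ozero_onat : ozero = onat 0.
Proof. by rewrite onatE. Qed.

Lemma is_tau_nbhs (alpha i : ord) (tau sigma : Topological (bicyclic alpha)) :
  onat 0 < alpha -> is_tau i tau -> is_tau i sigma ->
  forall (x : bicyclic alpha) V,
    nbhs (x : top_space tau) V -> nbhs (x : top_space sigma) V.
Proof.
move=> al ht hs; apply: nbhs_transfer => //.
- exact: tau_shift_continuous ht.
- exact: tau_hausdorff hs.
- exact: tau_shift_continuous hs.
move=> j hj V nV.
have iso : open ([set bdiag hj] : set (top_space sigma)) ->
    nbhs (bdiag hj : top_space sigma) V.
  move=> o; have xs : [set bdiag hj] `<=` V by move=> _ ->; apply: nbhs_singleton nV.
  by apply: filterS xs _; apply: open_nbhs_nbhs.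
have [ij|ji] := leP i (onat j); first by apply: iso; apply: tau_isolated hs _ _ _.
case: j => [|j] in hj V nV iso ji *.
  (* At j = 0 < i, isolation comes from shift-continuity and the Hausdorff property. *)
  apply: iso; rewrite (eq_irrelevance hj al); apply: open_bdiag0.
    exact: tau_hausdorff hs.
  exact: tau_shift_continuous hs.
by rewrite (tau_nbhs hs) // -(tau_nbhs ht).
Qed.

Theorem theorem15 (alpha : ord) (alpha_ge1 : onat 1 <= alpha)
    (alpha_le_omega : alpha <= omega)
    (tau : Topological (bicyclic alpha))
    (tau_lc : locally_compact [set: top_space tau])
    (tau_T2 : hausdorff_space (top_space tau))
    (tau_shift : shift_continuous tau) :
  exists i : ord,
    [/\ ozero < i, i <= alpha, is_tau i tau
      & forall sigma : Topological (bicyclic alpha),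
          is_tau i sigma -> same_topology tau sigma].
Proof.
have al : onat 0 < alpha by apply: lt_le_trans alpha_ge1; rewrite lt_onat.
suff [i [i0 ia ht]] : exists i : ord, [/\ ozero < i, i <= alpha & is_tau i tau].
  exists i; split=> // sigma hs U; rewrite !openE.
  split=> h x Ux; first exact: (is_tau_nbhs al ht hs (h x Ux)).
  exact: (is_tau_nbhs al hs ht (h x Ux)).
have build i : ozero < i ->
    (forall j (hj : onat j.+1 < alpha), i <= onat j.+1 ->
      open ([set bdiag hj] : set (top_space tau))) ->
    (forall j (hj : onat j.+1 < alpha), onat j.+1 < i ->
      ~ open ([set bdiag hj] : set (top_space tau))) -> is_tau i tau.
  move=> i0 hi hn; split=> // [[|j] hj ij|[|j] hj // _ ji].
  - by have := lt_le_trans i0 ij; rewrite ozero_onat ltxx.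
  - exact: hi.
  - by apply: nbhs_nonisolated => //; apply: hn.
(* i will be the least j + 1 with e_{j+1} isolated, or alpha if there is none. *)
pose P j := `[< exists hj : onat j.+1 < alpha,
  open ([set bdiag hj] : set (top_space tau)) >].
have [ex|nex] := pselect (exists j, P j); last first.
  exists alpha; split; rewrite ?ozero_onat //.
  apply: build; rewrite ?ozero_onat // => j hj.
    by move=> /(lt_le_trans hj); rewrite ltxx.
  by move=> _ o; apply: nex; exists j; apply/asboolP; exists hj.
have [j0 /asboolP[hj0 oj0] jmin] := ex_minnP ex.
exists (onat j0.+1); split; rewrite ?ozero_onat ?lt_onat // ?(ltW hj0) //.
apply: build; rewrite ?ozero_onat ?lt_onat // => j hj; last first.
  rewrite lt_onat ltnS ltnNge => /negP jj o; apply: jj; apply: jmin.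
  by apply/asboolP; exists hj.
rewrite leNgt lt_onat ltnS -leqNgt => /subnKC jE.
(* Isolation climbs from j0 by [isolated_next]. *)
move: (j - j0)%N jE hj => d <- {j}; elim: d => [|d IH] hj.
  by move: hj; rewrite addn0 => hj; rewrite (eq_irrelevance hj hj0).
move: hj; rewrite addnS => hj.
have hj' : onat (j0 + d).+1 < alpha by apply: lt_trans hj; rewrite lt_onat.
by apply: (isolated_next al tau_T2 tau_shift tau_lc (hk := hj')); apply: IH.
Qed.
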